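(* Let $P$ be a positive integer, $N=2^L$ with $L$ a positive integer, $D_1,\ldots,D_{N^P},R$ positive integers, $\mathcal{A}\in\mathbb{R}^{D_1\times\cdots\times D_{N^P}}$ and $\epsilon>0$. Let $\mu:[N]^P\to[N^P]$ be compatible, and suppose that for all canonical partitions $(\mathcal{K},\mathcal{K}^c)\in\mathcal{C}^P_N$ it holds that $\mathrm{QE}(\mathcal{A};\mu(\mathcal{K}))\le\frac{\epsilon^2}{(2N^P-3)\|\mathcal{A}\|^2}\ln(R)$. Then there exists an assignment of the tensors of the $P$-dimensional locally connected tensor network of width $R$ generating $\mathcal{W}^P_{\mathrm{TN}}\in\mathbb{R}^{D_1\times\cdots\times D_{N^P}}$ with $\|\mathcal{W}^P_{\mathrm{TN}}-\mathcal{A}\|\le\epsilon$.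
   Context: Norms are Frobenius. For a tensor $\mathcal{A}\in\mathbb{R}^{D_1\times\cdots\times D_{N^P}}$ and $\mathcal{J}\subseteq[N^P]$, $[\![\mathcal{A};\mathcal{J}]\!]$ is its matrix arrangement with rows indexed by axes $\mathcal{J}$ and columns by the remaining axes; $\mathrm{QE}(\mathcal{A};\mathcal{J}):=-\sum_d\rho_d\ln\rho_d$ with $\rho_d=\sigma_d^2/\sum_{d'}\sigma_{d'}^2$ over the singular values of $[\![\mathcal{A};\mathcal{J}]\!]$ ($\mathrm{QE}(0;\mathcal{J})=0$). The $P$-dimensional locally connected tensor network of width $R$ has as graph a perfect $2^P$-ary tree of height $L$ with $N^P$ leaves, open edge of leaf $n$ of dimension $D_n$, inner edges of dimension $R$; it generates exactly the tensors: choose $\phi^{(0,n)}_r\in\mathbb{R}^{D_n}$ ($n\in[N^P]$, $r\in[R]$); for $l=1,\ldots,L-1$, $n\in[2^{P(L-l)}]$, $r\in[R]$ set $\phi^{(l,n)}_r=\sum_{i_1,\ldots,i_{2^P}\in[R]}a^{(l,n)}_{r,i_1,\ldots,i_{2^P}}\bigotimes_{k=1}^{2^P}\phi^{(l-1,2^P(n-1)+k)}_{i_k}$; and $\mathcal{W}^P_{\mathrm{TN}}=\sum_{i_1,\ldots,i_{2^P}}a_{i_1,\ldots,i_{2^P}}\bigotimes_{k=1}^{2^P}\phi^{(L-1,k)}_{i_k}$. A bijection $\mu:[N]^P\to[N^P]$ is compatible if for every node, the preimage under $\mu$ of the axis indices descending from it is a contiguous cubic block of $[N]^P$; $\mu(\mathcal{K}):=\{\mu(\mathbf{n}):\mathbf{n}\in\mathcal{K}\}$.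 The canonical partitions $\mathcal{C}^P_N$ of $[N]^P$ are the pairs $(\mathcal{K},[N]^P\setminus\mathcal{K})$ with $\mathcal{K}=\times_{p=1}^P\{2^{L-l}(n_p-1)+1,\ldots,2^{L-l}n_p\}$ for $l\in\{0,\ldots,L\}$, $n_1,\ldots,n_P\in[2^l]$. *)

(* Defs.v *)
From HB Require Import structures.
From mathcomp Require Import all_boot all_order all_algebra.
From mathcomp Require Import boolp reals exp.
Set Implicit Arguments. Unset Strict Implicit. Unset Printing Implicit Defensive.
Import Order.TTheory GRing.Theory Num.Theory.
Local Open Scope ring_scope.

Section Tensors.
Variable R : realType.

Variables (K : nat) (D : 'I_K -> nat).

Definition tidx := {dffun forall n : 'I_K, 'I_(D n)}.
Definition tensor := tidx -> R.

Definition fnorm (A : tensor) : R := Num.sqrt (\sum_(i : tidx) A i ^+ 2).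

Definition rowT (J : {set 'I_K}) :=
  {dffun forall n : {x : 'I_K | x \in J}, 'I_(D (val n))}.
Definition colT (J : {set 'I_K}) :=
  {dffun forall n : {x : 'I_K | x \notin J}, 'I_(D (val n))}.

Definition merge_idx (J : {set 'I_K}) (r : rowT J) (c : colT J) : tidx :=
  [ffun n => match (n \in J) as b return (n \in J) = b -> 'I_(D n) with
             | true => fun h => r (exist (fun x => x \in J) n h)
             | false => fun h => c (exist (fun x => x \notin J) n (negbT h))
             end erefl].

Definition matricize (A : tensor) (J : {set 'I_K}) : rowT J -> colT J -> R :=
  fun r c => A (merge_idx r c).

End Tensors.

Section SVD.
Variable R : realType.

Definition is_svd (X Y : finType) (M : X -> Y -> R) (s : seq R) : Prop :=
  exists (u : nat -> X -> R) (v : nat -> Y -> R),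
    [/\ forall d, (d < size s)%N -> 0 <= s`_d,
        forall d d', (d < size s)%N -> (d' < size s)%N ->
          \sum_(x : X) u d x * u d' x = (d == d')%:R,
        forall d d', (d < size s)%N -> (d' < size s)%N ->
          \sum_(y : Y) v d y * v d' y = (d == d')%:R
      & forall x y, M x y = \sum_(d < size s) s`_d * u d x * v d y].

Definition singvals (X Y : finType) (M : X -> Y -> R) : seq R :=
  match pselect (exists s, is_svd M s) with
  | left h => sval (cid h)
  | right _ => [::]
  end.

Definition QEmat (X Y : finType) (M : X -> Y -> R) : R :=
  let s := singvals M in
  let tot := \sum_(x <- s) x ^+ 2 in
  if tot == 0 then 0
  else - \sum_(x <- s) (x ^+ 2 / tot) * ln (x ^+ 2 / tot).

Definition QE (K : nat) (D : 'I_K -> nat) (A : tensor R D) (J : {set 'I_K}) : R :=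
  QEmat (@matricize R K D A J).

End SVD.

Section Network.
Variable R : realType.
Variables (P L rk : nat).

Definition nleaves := ((2 ^ L) ^ P)%N.

Variable D : 'I_nleaves -> nat.

(* phi^{(l,n)}_r, 0-based node index n at level l, represented as a function
   on the full multi-index depending only on the coordinates of the leaves
   below node (l,n); the tensor product of children (which act on disjoint
   consecutive blocks of axes) is then the pointwise product. *)
Fixpoint tn_phi (phi0 : forall n : 'I_nleaves, 'I_rk -> 'I_(D n) -> R)
    (a : nat -> nat -> 'I_rk -> {ffun 'I_(2 ^ P) -> 'I_rk} -> R)
    (l n : nat) (r : 'I_rk) (i : tidx D) : R :=
  match l with
  | 0 => match @insub nat (fun m => m < nleaves)%N 'I_nleaves n with
         | Some m => phi0 m r (i m)
         | None => 0
         end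
  | l'.+1 => \sum_(c : {ffun 'I_(2 ^ P) -> 'I_rk})
               a l n r c * \prod_(k < 2 ^ P) tn_phi phi0 a l' (2 ^ P * n + k) (c k) i
  end.

Definition tn_tensor (phi0 : forall n : 'I_nleaves, 'I_rk -> 'I_(D n) -> R)
    (a : nat -> nat -> 'I_rk -> {ffun 'I_(2 ^ P) -> 'I_rk} -> R)
    (atop : {ffun 'I_(2 ^ P) -> 'I_rk} -> R) : tensor R D :=
  fun i => \sum_(c : {ffun 'I_(2 ^ P) -> 'I_rk})
             atop c * \prod_(k < 2 ^ P) tn_phi phi0 a L.-1 k (c k) i.

Definition gridT := {ffun 'I_P -> 'I_(2 ^ L)}.

(* axis indices (leaves) descending from node (l,n), l = 0 leaves, l = L root *)
Definition node_leaves (l n : nat) : {set 'I_nleaves} :=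
  [set m : 'I_nleaves | (m %/ 2 ^ (P * l) == n)%N].

Definition cubic_block (B : {set gridT}) : Prop :=
  exists (s : nat) (a : 'I_P -> nat),
    B = [set x : gridT | [forall p, (a p <= x p)%N && (x p < a p + s)%N]].

Definition compatible (mu : gridT -> 'I_nleaves) : Prop :=
  bijective mu /\
  forall l n, (l <= L)%N -> (n < 2 ^ (P * (L - l)))%N ->
    cubic_block (mu @^-1: node_leaves l n).

Definition canon_block (l : nat) (np : 'I_P -> nat) : {set gridT} :=
  [set x : gridT | [forall p, (x p %/ 2 ^ (L - l) == np p)%N]].

End Network.

(* Main.v *)
Require Import Defs.
From HB Require Import structures.
From mathcomp Require Import all_boot all_order all_algebra.
From mathcomp Require Import boolp reals exp.
From mathcomp Require Import complex ring zify.
Set Implicit Arguments. Unset Strict Implicit. Unset Printing Implicit Defensive.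
Import Order.TTheory GRing.Theory Num.Theory.
Local Open Scope ring_scope.

(** If the normalized squared singular values rho_d have entropy at most
    delta ln R, then at most R of them exceed 1/(R+1), and each of the others
    contributes at least rho_d ln(R+1), so their total mass is at most delta.
    Hence at every node of the tree the projection onto at most R left singular
    vectors moves A by at most eps^2 / (2 N^P - 3) in squared norm.

    Compose the projections of all nodes, those of the leaves outermost. Since
    |A - pi G|^2 <= |A - pi A|^2 + |A - G|^2 for an orthogonal projection pi,
    the squared error is at most the sum over the nodes. The composition is an
    element of the network: projecting the singular vectors of a node onto the
    products of those of its children is exactly one step of the recursion, the
    coefficients being inner products. There are at most 2 N^P - 3 non-root nodes
    if P >= 2; if P = 1 there are 2 N - 2, but the two children of the root can
    use the two sides of one and the same decomposition.

    Compatible maps send the nodes exactly to the canonical blocks, because the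
    nodes of one level tile the grid by boxes of equal volume. *)

(** * Singular value decomposition of real matrices *)

Lemma row_dotE (R : realType) n (x : 'rV[R]_n) :
  x *m x^T = (\sum_j x 0 j ^+ 2)%:M.
Proof.
apply/matrixP => i j; rewrite !ord1 !mxE eqxx mulr1n.
by apply: eq_bigr => k _; rewrite !mxE expr2.
Qed.

Lemma row_dotC (R : realType) n (x y : 'rV[R]_n) : x *m y^T = y *m x^T.
Proof.
by apply/matrixP => i j; rewrite !ord1 !mxE; apply: eq_bigr => k _; rewrite !mxE mulrC.
Qed.

Lemma row_dot_eq0 (R : realType) n (x : 'rV[R]_n) :
  (\sum_j x 0 j ^+ 2 == 0) = (x == 0).
Proof.
apply/idP/eqP => [|->]; last by rewrite big1// => j _; rewrite mxE expr0n.
rewrite psumr_eq0 => [/allP h|j _]; last exact: sqr_ge0.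
apply/rowP => j; rewrite mxE; apply/eqP.
by rewrite -sqrf_eq0; apply: h; rewrite mem_index_enum.
Qed.

(** A complex root of the characteristic polynomial gives an eigenvector $x + iy$. Symmetry makes
    the imaginary part of the eigenvalue times $|x|^2 + |y|^2$ vanish, so [x] or [y] is a real
    eigenvector. *)
Lemma symmetric_eigenvector (R : realType) n (A : 'M[R]_n.+1) : A^T = A ->
  exists (a : R) (v : 'rV[R]_n.+1), v != 0 /\ v *m A = a *: v.
Proof.
move=> As.
pose toC := real_complex R.
have [z rz] : exists z : R[i], root (char_poly (map_mx toC A)) z.
  by apply/closed_rootP; rewrite size_char_poly.
rewrite -eigenvalue_root_char in rz.
have /eigenvalueP[w wA w0] := rz.
pose x := map_mx (@complex.Re R) w; pose y := map_mx (@complex.Im R) w.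
have [xA yA] : x *m A = complex.Re z *: x - complex.Im z *: y /\
               y *m A = complex.Re z *: y + complex.Im z *: x.
  have ReD : {morph (@complex.Re R) : a b / a + b} by move=> [? ?] [? ?].
  have ImD : {morph (@complex.Im R) : a b / a + b} by move=> [? ?] [? ?].
  split; apply/rowP => j; have /rowP/(_ j) := wA; rewrite !mxE => h.
  - have := congr1 (@complex.Re R) h; rewrite (big_morph _ ReD erefl).
    under eq_bigr => k _ do rewrite !mxE.
    case: (z) (w _ _) => [zr zi] [wr wi] /= <-.
    apply: eq_bigr => k _; rewrite !mxE; case: (w _ _) => a b /=.
    by rewrite mulr0 subr0.
  - have := congr1 (@complex.Im R) h; rewrite (big_morph _ ImD erefl).
    under eq_bigr => k _ do rewrite !mxE.
    case: (z) (w _ _) => [zr zi] [wr wi] /= <-.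
    apply: eq_bigr => k _; rewrite !mxE; case: (w _ _) => a b /=.
    by rewrite mulr0 add0r.
have xyn0 : (x != 0) || (y != 0).
  rewrite -negb_and; apply: contra w0 => /andP[/eqP/rowP x0 /eqP/rowP y0].
  apply/eqP/rowP => j; have := x0 j; have := y0 j; rewrite !mxE.
  by case: (w 0 j) => a b /= -> ->.
have b0 : complex.Im z = 0.
  have : (x *m A) *m y^T = (y *m A) *m x^T.
    by rewrite row_dotC trmx_mul As mulmxA.
  rewrite xA yA mulmxBl mulmxDl -!scalemxAl (row_dotC x y) !row_dotE.
  move/addrI/eqP; rewrite eq_sym -subr_eq0 opprK -scalerDr => /eqP/matrixP/(_ 0 0).
  rewrite !mxE !eqxx !mulr1n => /eqP; rewrite mulf_eq0 => /orP[/eqP//|].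
  rewrite paddr_eq0; [|by apply: sumr_ge0 => j _; exact: sqr_ge0..].
  by rewrite !row_dot_eq0; case/andP=> h1 h2; rewrite h1 h2 in xyn0.
exists (complex.Re z); rewrite b0 !scale0r addr0 subr0 in xA yA.
by case/orP: xyn0 => h; [exists x | exists y].
Qed.

(** The reflection in the hyperplane orthogonal to $v - e_0$ exchanges the unit vectors $v$ and
    $e_0$. *)
Lemma householder (R : realType) n (v : 'rV[R]_n.+1) : v *m v^T = 1 ->
  exists H : 'M[R]_n.+1, [/\ H^T = H, H *m H = 1%:M & row 0 H = v].
Proof.
move=> v1; pose e : 'rV[R]_n.+1 := delta_mx 0 0; pose w := v - e.
have ee : e *m e^T = 1.
  by rewrite trmx_delta mul_delta_mx; apply/matrixP=> i j; rewrite !ord1 !mxE.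
have [w0|wn0] := eqVneq w 0.
  exists 1%:M; split; rewrite ?trmx1 ?mulmx1 //.
  by move/subr0_eq: w0 => ->; rewrite row1.
pose s := \sum_j w 0 j ^+ 2.
have s0 : s != 0 by rewrite row_dot_eq0.
have ws : w *m w^T = s%:M by rewrite row_dotE.
(* As [v] and [e] are unit vectors, $|w|^2 = -2 \langle e, w \rangle$. *)
have ew : (2 / s) *: (e *m w^T) = - 1.
  have : w *m w^T = - 2 *: (e *m w^T).
    rewrite /w linearB /= !mulmxBl !mulmxBr v1 ee.
    rewrite (row_dotC v e) scalerBr !scaleNr opprK !scaler_nat !mulr2n opprD.
    by rewrite opprK [X in _ + X]addrC addrACA -opprD addrC.
  rewrite ws => h; have : (2 / s) *: (e *m w^T) = - (s^-1 *: (- 2 *: (e *m w^T))).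
    by rewrite scaleNr scalerN opprK scalerA mulrC.
  by rewrite -h scale_scalar_mx mulVf.
exists (1%:M - (2 / s) *: (w^T *m w)); split.
- by rewrite linearB /= trmx1 linearZ /= trmx_mul trmxK.
- have : (w^T *m w) *m (w^T *m w) = s *: (w^T *m w).
    by rewrite mulmxA -[w^T *m w *m w^T]mulmxA ws mul_mx_scalar -scalemxAl.
  move: (w^T *m w) => X XX.
  rewrite mulmxBl mul1mx mulmxBr mulmx1 -scalemxAl -scalemxAr XX !scalerA.
  rewrite -mulrA (divfK s0) mulr_natr mulr2n scalerDl.
  by rewrite opprB addrK subrK.
- rewrite rowE.
  have -> : e *m (1%:M - (2 / s) *: (w^T *m w)) = e - (2 / s) *: (e *m w^T) *m w.
    by move: (w^T *m w) (mulmxA e w^T w) => X h; rewrite mulmxBr mulmx1 -scalemxAr h -scalemxAl.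
  by rewrite ew mulNmx mul1mx opprK /w addrC subrK.
Qed.

(** Deflation: conjugating by a reflection whose first row is a unit eigenvector clears the first
    row and, by symmetry, the first column off the diagonal; induction treats the remaining
    block. *)
Lemma symmetric_spectral (R : realType) n (A : 'M[R]_n) : A^T = A ->
  exists (Q : 'M[R]_n) (d : 'rV[R]_n),
    Q *m Q^T = 1%:M /\ A = Q^T *m diag_mx d *m Q.
Proof.
elim: n A => [|n IH] A As.
  by exists 1%:M, 0; split; apply/matrixP => - [].
have [a [v [vn0 vA]]] := symmetric_eigenvector As.
pose t := Num.sqrt (\sum_j v 0 j ^+ 2).
have t0 : t != 0.
  rewrite sqrtr_eq0 -ltNge lt_neqAle eq_sym row_dot_eq0 vn0.
  by apply: sumr_ge0 => j _; exact: sqr_ge0.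
pose u := t^-1 *: v.
have uu : u *m u^T = 1.
  have tt : t ^+ 2 = \sum_j v 0 j ^+ 2.
    by rewrite sqr_sqrtr //; apply: sumr_ge0 => j _; exact: sqr_ge0.
  rewrite /u linearZ /= -scalemxAl -scalemxAr row_dotE -tt.
  by rewrite scalerA scale_scalar_mx -invfM -expr2 mulVf // expf_neq0.
have uA : u *m A = a *: u by rewrite -scalemxAl vA !scalerA mulrC.
have [H [Hs HH Hr]] := householder uu.
pose B : 'M_(1 + n) := H *m A *m H.
have Bs : B^T = B by rewrite /B !trmx_mul Hs As mulmxA.
have B0 : row 0 B = a *: delta_mx 0 0.
  rewrite !row_mul Hr uA -scalemxAl -Hr -row_mul HH row1 //.
have AB : A = H *m B *m H.
  by rewrite /B !mulmxA HH mul1mx -mulmxA HH mulmx1.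
move: B Bs B0 AB => B Bs B0 AB.
have Bblock : B = block_mx (a%:M : 'M_1) 0 0 (drsubmx B).
  have ur : ursubmx B = 0.
    apply/rowP => j; have /rowP/(_ (rshift 1 j)) := B0.
    by rewrite !mxE /= mulr0 => <-; congr (fun_of_matrix B _ _); apply: val_inj.
  rewrite -[LHS]submxK ur; congr block_mx.
    apply/matrixP => i j; have /rowP/(_ 0) := B0.
    rewrite !ord1 !mxE /= mulr1 mulr1n => <-.
    by congr (fun_of_matrix B _ _); apply: val_inj.
  by rewrite -[LHS]trmxK trmx_dlsub Bs ur trmx0.
have [Q [d [QQ Cd]]] : exists (Q : 'M_n) (d : 'rV_n),
    Q *m Q^T = 1%:M /\ drsubmx B = Q^T *m diag_mx d *m Q.
  by apply: IH; rewrite trmx_drsub Bs.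
pose Q1 : 'M_(1 + n) := block_mx 1 0 0 Q.
have Q1Q1 : Q1 *m Q1^T = 1%:M.
  rewrite /Q1 tr_block_mx mulmx_block !trmx0 trmx1 !mulmx0 !mul0mx mulmx1 !addr0 add0r.
  by rewrite QQ -scalar_mx_block.
have BQ : B = Q1^T *m diag_mx (row_mx (a%:M : 'rV_1) d) *m Q1.
  rewrite Bblock Cd diag_mx_row /Q1 tr_block_mx !mulmx_block.
  rewrite !trmx0 trmx1 !mulmx0 !mul0mx !mulmx1 !mul1mx !addr0 !add0r.
  rewrite !mul0mx; congr block_mx.
  by apply/matrixP => i j; rewrite !ord1 !mxE eqxx.
exists (Q1 *m H), (row_mx a%:M d : 'rV_(1 + n)); split.
  by rewrite trmx_mul mulmxA -[Q1 *m H *m _]mulmxA Hs HH mulmx1.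
by rewrite AB BQ trmx_mul Hs !mulmxA.
Qed.

(** Diagonalizing the Gram matrix of the rows gives an orthogonal [Q] for which the rows of $QM$ are
    orthogonal, with the eigenvalues as squared norms; normalized, they are the right singular
    vectors. *)
Lemma svd_exists (R : realType) (X Y : finType) (M : X -> Y -> R) :
  exists s, is_svd M s.
Proof.
have [x0 _|X0] := pickP X; last first.
  by exists [::], (fun _ _ => 0), (fun _ _ => 0); split=> // x; have := X0 x.
pose G : 'M[R]_#|X| := \matrix_(i, j) \sum_y M (enum_val i) y * M (enum_val j) y.
have [Q [d [QQ Gd]]] : exists (Q : 'M[R]_#|X|) (d : 'rV[R]_#|X|),
    Q *m Q^T = 1%:M /\ G = Q^T *m diag_mx d *m Q.
  apply: symmetric_spectral; apply/matrixP => i j; rewrite !mxE.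
  by apply: eq_bigr => y _; rewrite mulrC.
pose N i y := \sum_j Q i j * M (enum_val j) y.
have NN i j : \sum_y N i y * N j y = d 0 i *+ (i == j).
  have /matrixP/(_ i j) : Q *m G *m Q^T = diag_mx d.
    by rewrite Gd !mulmxA QQ mul1mx -mulmxA QQ mulmx1.
  rewrite [RHS]mxE => <-; rewrite mxE.
  under [RHS]eq_bigr => k _.
    rewrite mxE mulr_suml.
    under eq_bigr => l _ do rewrite !mxE mulr_sumr mulr_suml.
    rewrite exchange_big /=; over.
  rewrite exchange_big; apply: eq_bigr => y _ /=.
  rewrite /N mulr_sumr; apply: eq_bigr => k _; rewrite mulr_suml.
  by apply: eq_bigr => l _; ring.
have N0 i y : d 0 i = 0 -> N i y = 0.
  move=> di; have := NN i i; rewrite di mul0rn => /eqP.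
  rewrite psumr_eq0 => [/allP/(_ y (mem_index_enum _))|z _]; last exact: sqr_ge0.
  by rewrite -expr2 sqrf_eq0 => /eqP.
have d_ge0 i : 0 <= d 0 i.
  by have := NN i i; rewrite eqxx mulr1n => <-; apply: sumr_ge0 => y _; exact: sqr_ge0.
have MN x y : M x y = \sum_i Q i (enum_rank x) * N i y.
  rewrite /N; under eq_bigr => i _ do rewrite mulr_sumr.
  rewrite exchange_big /=.
  have QtQ : Q^T *m Q = 1%:M by apply: mulmx1C.
  under eq_bigr => j _.
    under eq_bigr => i _ do rewrite mulrA.
    rewrite -mulr_suml.
    have -> : \sum_i Q i (enum_rank x) * Q i j = (enum_rank x == j)%:R.
      have /matrixP/(_ (enum_rank x) j) := QtQ; rewrite !mxE => <-.
      by apply: eq_bigr => i _; rewrite mxE.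
    over.
  rewrite (bigD1 (enum_rank x)) //= eqxx mul1r enum_rankK big1 ?addr0 // => j.
  by rewrite eq_sym => /negbTE ->; rewrite mul0r.
(* Rows with eigenvalue zero vanish and are dropped; only the others can be normalized. *)
pose I := enum [pred i | d 0 i != 0]; pose i0 := enum_rank x0.
exists [seq Num.sqrt (d 0 i) | i <- I].
exists (fun k x => Q (nth i0 I k) (enum_rank x)).
exists (fun k y => N (nth i0 I k) y / Num.sqrt (d 0 (nth i0 I k))).
have IP k : (k < size I)%N -> d 0 (nth i0 I k) != 0.
  by move=> kI; have := mem_nth i0 kI; rewrite mem_enum.
rewrite size_map; split.
- by move=> k kI; rewrite (nth_map i0) // sqrtr_ge0.
- move=> k k' kI k'I.
  have /matrixP/(_ (nth i0 I k) (nth i0 I k')) := QQ.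
  rewrite !mxE nth_uniq ?enum_uniq // => <-.
  rewrite [RHS](reindex (@enum_rank X)) /=; last first.
    by exists enum_val => i _; rewrite ?enum_valK ?enum_rankK.
  by apply: eq_bigr => i _; rewrite mxE.
- move=> k k' kI k'I.
  under eq_bigr do rewrite mulrACA.
  rewrite -mulr_suml NN nth_uniq ?enum_uniq //.
  have [->|_] := eqVneq k k'; last by rewrite mul0r.
  by rewrite mulr1n -invfM -expr2 sqr_sqrtr // mulfV // IP.
- move=> x y; rewrite MN (bigID (fun i => d 0 i != 0)) /= [X in _ + X]big1 ?addr0; last first.
    by move=> i; rewrite negbK => /eqP/(N0 _ y) ->; rewrite mulr0.
  transitivity (\sum_(i <- I) Q i (enum_rank x) * N i y).
    by rewrite /I big_enum.
  rewrite (big_nth i0) big_mkord; apply: eq_bigr => k _.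
  rewrite (nth_map i0) //; set t := Num.sqrt _.
  have t0 : t != 0 by rewrite sqrtr_eq0 -ltNge lt_neqAle d_ge0 eq_sym IP.
  by rewrite -mulrA mulrCA [t * _]mulrC divfK.
Qed.

(** * Entropy bounds the tail of the singular values *)

Lemma sum_div_sumsq (R : realType) (s : seq R) (tot : R) :
  tot = \sum_(x <- s) x ^+ 2 -> tot != 0 ->
  \sum_(d < size s) s`_d ^+ 2 / tot = 1.
Proof.
move=> -> t0; rewrite -mulr_suml; apply/eqP; rewrite -(inj_eq (mulIf t0)).
by rewrite divfK // mul1r (big_nth 0) big_mkord.
Qed.

(* At most [rk] weights can exceed [1 / (rk + 1)], and each remaining weight
   carries an entropy of at least [ln (rk + 1)] per unit of mass. *)
Lemma entropy_tail (R : realType) (s : seq R) (tot delta : R) (rk : nat) :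
  (0 < rk)%N -> 0 <= delta -> tot = \sum_(x <- s) x ^+ 2 -> 0 < tot ->
  - \sum_(x <- s) (x ^+ 2 / tot) * ln (x ^+ 2 / tot) <= delta * ln rk%:R ->
  exists S : {set 'I_(size s)},
    (#|S| <= rk)%N /\ \sum_(d in ~: S) s`_d ^+ 2 <= delta * tot.
Proof.
move=> rk0 delta0 totE tot0 ent.
pose p (d : 'I_(size s)) := s`_d ^+ 2 / tot.
have p_ge0 d : 0 <= p d by rewrite divr_ge0 ?sqr_ge0 // ltW.
have p1 : \sum_d p d = 1 by apply: sum_div_sumsq => //; rewrite gt_eqF.
have p_le1 d : p d <= 1 by rewrite -p1 (bigD1 d) //= lerDl sumr_ge0.
pose S := [set d | rk.+1%:R^-1 < p d].
exists S; split.
  rewrite leqNgt; apply/negP => rkS.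
  have : \sum_(d in S) p d <= 1.
    by rewrite -p1 [leRHS](bigID [in S]) /= lerDl sumr_ge0.
  rewrite leNgt => /negP; apply.
  have [d0 d0S] : exists d, d \in S by apply/set0Pn; rewrite -card_gt0 (leq_ltn_trans _ rkS).
  have : \sum_(d in S) rk.+1%:R^-1 < \sum_(d in S) p d.
    apply: ltr_sum => [|d]; last by rewrite inE.
    by apply/hasP; exists d0; rewrite ?mem_index_enum.
  apply: le_lt_trans; rewrite sumr_const -(mulr_natl _ #|S|).
  by rewrite ler_pdivlMr ?ltr0n // mul1r ler_nat.
(* Unlike [ln rk], this is positive also for [rk = 1], so it can be cancelled. *)
have ln0 : 0 < ln rk.+1%:R :> R by rewrite ln_gt0 // ltr1n.
have -> : \sum_(d in ~: S) s`_d ^+ 2 = (\sum_(d in ~: S) p d) * tot.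
  by rewrite -mulr_suml divfK // gt_eqF.
rewrite ler_pM2r // -(ler_pM2r ln0).
apply: (@le_trans _ _ (delta * ln rk%:R)); last first.
  by rewrite ler_wpM2l // ler_ln ?posrE ?ltr0n // ler_nat.
apply: le_trans ent.
rewrite (big_nth 0) big_mkord -sumrN [leRHS](bigID [in ~: S]) /= mulr_suml.
rewrite -[leLHS]addr0 lerD //; last first.
  by apply: sumr_ge0 => d _; rewrite -/(p d) -mulrN mulr_ge0 ?p_ge0 // oppr_ge0 ln_le0.
apply: ler_sum => d; rewrite !inE -leNgt => pd.
rewrite -/(p d) -mulrN; have [->|pd0] := eqVneq (p d) 0; first by rewrite !mul0r.
rewrite ler_wpM2l // lerNr -lnV ?posrE ?ltr0n // ler_ln ?posrE ?invr_gt0 ?ltr0n //.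
by rewrite lt_neqAle eq_sym pd0 p_ge0.
Qed.

(** * Nodes of a compatible tree are canonical blocks *)

Section Grid.
Local Open Scope nat_scope.
Variables (P L : nat).

Lemma card_ord_divn (K m q : nat) : (0 < m)%N -> (m * q.+1 <= K)%N ->
  #|[set j : 'I_K | j %/ m == q]| = m.
Proof.
move=> m0 mK.
have lt (j : 'I_m) : (m * q + j < K)%N.
  by rewrite (leq_trans _ mK) // mulnS addnC ltn_add2r.
have -> : [set j : 'I_K | j %/ m == q] = [set Ordinal (lt j) | j : 'I_m].
  apply/setP => j; rewrite !inE; apply/eqP/imsetP => [jq|[i _ ->]] /=; last first.
    by rewrite mulnC divnMDl // divn_small ?addn0.
  exists (Ordinal (ltn_pmod j m0)) => //; apply: val_inj => /=.
  by rewrite -jq mulnC -divn_eq.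
rewrite card_imset ?card_ord // => i j /(congr1 val) /= /addnI ij.
exact: val_inj.
Qed.

Lemma leaf_node_lt (l : nat) (m : 'I_(nleaves P L)) : (l <= L)%N ->
  (m %/ 2 ^ (P * l) < 2 ^ (P * (L - l)))%N.
Proof.
move=> lL; rewrite ltn_divLR ?expn_gt0 // -expnD -mulnDr subnK //.
by rewrite mulnC expnM.
Qed.

Lemma card_node_leaves (l n : nat) : (l <= L)%N -> (n < 2 ^ (P * (L - l)))%N ->
  #|node_leaves P L l n| = (2 ^ (P * l))%N.
Proof.
move=> lL nl; apply: card_ord_divn; rewrite ?expn_gt0 //.
rewrite /nleaves -expnM mulnC [leqRHS](_ : _ = 2 ^ (P * (L - l)) * 2 ^ (P * l))%N.
  by rewrite leq_mul2r nl orbT.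
by rewrite -expnD -mulnDr subnK // mulnC.
Qed.

(** Canonical blocks counted from the leaves: side [2 ^ l], the scale of the nodes of level [l]. *)
Definition cube (l : nat) (q : 'I_P -> nat) : {set gridT P L} :=
  [set x : gridT P L | [forall p, (x p %/ 2 ^ l == q p)%N]].

Lemma card_cube (l : nat) (q : 'I_P -> nat) : (l <= L)%N ->
  (forall p, q p < 2 ^ (L - l))%N -> #|cube l q| = (2 ^ (P * l))%N.
Proof.
move=> lL ql.
rewrite cardsE -(@eq_card _ (family (fun p => [pred j : 'I_(2 ^ L) | j %/ 2 ^ l == q p]%N))); last first.
  by move=> x; rewrite !inE; apply: eq_forallb => p; rewrite inE.
rewrite card_family /image_mem (@eq_map _ _ _ (fun=> 2 ^ l)%N) => [|p]; last first.
  rewrite -cardsE card_ord_divn ?expn_gt0 //.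
  by rewrite -[in leqRHS](subnKC lL) expnD leq_pmul2l ?expn_gt0.
have -> (T : Type) (s : seq T) : foldr muln 1%N [seq (2 ^ l)%N | _ <- s] = (2 ^ (l * size s))%N.
  elim: s => [|x s IH]; first by rewrite muln0.
  by rewrite /= IH mulnS expnD.
by rewrite -cardE card_ord mulnC.
Qed.

Variable mu : gridT P L -> 'I_(nleaves P L).
Hypothesis mu_comp : compatible mu.

(* The boxes of one level tile the grid: ordering the aligned cubes by the sum
   of the coordinates of their corners, the lower corner of the box that
   contains the corner of a cube cannot lie in an earlier cube, so the two
   corners agree; box and cube are then nested and equal by cardinality. *)
Lemma cube_is_node (l : nat) (q : 'I_P -> nat) : (l <= L)%N ->
  (forall p, q p < 2 ^ (L - l))%N ->
  exists n, (n < 2 ^ (P * (L - l)))%N /\ mu @^-1: node_leaves P L l n = cube l q.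
Proof.
move=> lL; have [mu_bij mu_cubic] := mu_comp.
have [k] := ubnP (\sum_p q p); elim: k q => // k IH q; rewrite ltnS => qk ql.
have lt p : (2 ^ l * q p < 2 ^ L)%N.
  by rewrite -[in ltnRHS](subnKC lL) expnD ltn_pmul2l ?expn_gt0.
pose x : gridT P L := [ffun p => Ordinal (lt p)].
have xq p : (x p %/ 2 ^ l = q p)%N by rewrite ffunE /= mulKn // expn_gt0.
pose n := (mu x %/ 2 ^ (P * l))%N.
have nl : (n < 2 ^ (P * (L - l)))%N by exact: leaf_node_lt.
exists n; split=> //.
have [s [a Bdef]] := mu_cubic l n lL nl.
have cardB : #|mu @^-1: node_leaves P L l n| = (2 ^ (P * l))%N.
  by rewrite on_card_preimset ?card_node_leaves //; exact: onW_bij.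
have xB : x \in mu @^-1: node_leaves P L l n by rewrite !inE.
have ax p : (a p <= 2 ^ l * q p)%N && (2 ^ l * q p < a p + s)%N.
  by move: xB; rewrite Bdef inE => /forallP/(_ p); rewrite ffunE.
have alt p : (a p < 2 ^ L)%N by apply: leq_ltn_trans (lt p); case/andP: (ax p).
pose y : gridT P L := [ffun p => Ordinal (alt p)].
have yB : y \in mu @^-1: node_leaves P L l n.
  rewrite Bdef inE; apply/forallP => p; rewrite ffunE /= leqnn -ltn_subLR // subnn.
  by case/andP: (ax p); lia.
pose q' p := (a p %/ 2 ^ l)%N.
have q'q p : (q' p <= q p)%N.
  by rewrite /q' -(xq p) ffunE leq_div2r //=; case/andP: (ax p).
have aq p : a p = (2 ^ l * q p)%N.
  (* An earlier cube [q'] holding the corner [y] is a node by induction, hence the node of [x]; then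
     [x] would lie in it, against [q' p0 < q p0]. *)
  have [p0|q'_ge] := pickP [pred p | q' p < q p]%N; last first.
    apply/eqP; rewrite eqn_leq; case/andP: (ax p) => -> _ /=.
    have := q'_ge p; rewrite /= ltnNge => /negbFE.
    by rewrite /q' leq_divRL ?expn_gt0 // mulnC.
  move=> /= lt0.
  have [|p1|n' [_ n'E]] := IH q'; first 2 last.
  - have y' : y \in cube l q' by rewrite inE; apply/forallP => p1; rewrite ffunE.
    move: yB; rewrite -n'E !inE in y' * => /eqP yn; rewrite yn in y'.
    move: xB; rewrite !inE (eqP y') => xn'.
    have : x \in cube l q' by rewrite -n'E !inE.
    rewrite inE => /forallP/(_ p0); rewrite xq => /eqP q0.
    by rewrite q0 ltnn in lt0.
  - apply: leq_trans qk; rewrite (bigD1 p0) //= [leqRHS](bigD1 p0) //=.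
    by rewrite -addSn leq_add // leq_sum.
  - exact: leq_ltn_trans (q'q p1) (ql p1).
have cubeE z : (z \in cube l q) = [forall p, (a p <= z p)%N && (z p < a p + 2 ^ l)%N].
  rewrite inE; apply: eq_forallb => p; rewrite aq eqn_leq.
  rewrite leq_divRL ?expn_gt0 // -ltnS ltn_divLR ?expn_gt0 // mulSn addnC.
  by rewrite andbC [(q p * _)%N]mulnC.
apply/eqP; have [sl|ls] := leqP s (2 ^ l).
  rewrite eqEcard cardB card_cube // leqnn andbT; apply/subsetP => z.
  rewrite Bdef cubeE inE => /forallP h; apply/forallP => p.
  by have /andP[-> zs] := h p; rewrite (leq_trans zs) ?leq_add2l.
rewrite eq_sym eqEcard cardB card_cube // leqnn andbT; apply/subsetP => z.
rewrite Bdef cubeE inE => /forallP h; apply/forallP => p.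
by have /andP[-> zs] := h p; rewrite (leq_trans zs) // leq_add2l ltnW.
Qed.

(** The cube around the preimage of one leaf of the node is itself a node of this level, and nodes
    of one level that share a leaf coincide. *)
Lemma node_is_canonical (l n : nat) : (l <= L)%N -> (n < 2 ^ (P * (L - l)))%N ->
  exists np : 'I_P -> nat, (forall p, np p < 2 ^ (L - l))%N /\
    node_leaves P L l n = mu @: canon_block L (L - l) np.
Proof.
move=> lL nl; have [[nu muK nuK] _] := mu_comp.
have /card_gt0P[m mn] : (0 < #|node_leaves P L l n|)%N.
  by rewrite card_node_leaves // expn_gt0.
pose q p := (nu m p %/ 2 ^ l)%N.
have ql p : (q p < 2 ^ (L - l))%N.
  by rewrite ltn_divLR ?expn_gt0 // -expnD subnK.
exists q; split=> //.
have [n' [_ n'E]] := cube_is_node lL ql.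
have : nu m \in cube l q by rewrite inE; apply/forallP.
rewrite -n'E !inE nuK => /eqP mn'.
move: mn; rewrite inE mn' => /eqP n'n.
rewrite /canon_block subKn // -/(cube l q) -n'E n'n.
apply/setP => z; apply/idP/imsetP => [zn|[t tn ->]]; last by rewrite inE in tn.
by exists (nu z); rewrite ?inE nuK // in zn *.
Qed.

End Grid.

(** * Kernel operators acting on a block of axes *)

Section TensorOperators.
Variables (R : realType) (K : nat) (D : 'I_K -> nat).
Implicit Types (i j k : tidx D) (J : {set 'I_K}) (F G : tensor R D).

(* Agreement outside [J]: a sum over [agree J i] runs over the axes in [J]. *)
Definition agree J i j : bool := [forall n, (n \notin J) ==> (j n == i n)].

Definition mix J i j : tidx D := [ffun n => if n \in J then i n else j n].

(** Such an [F] stands for a tensor on the axes in [J] alone; keeping full indices avoids transports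
    between blocks. *)
Definition depends_on J F : Prop :=
  forall i j, (forall n, n \in J -> i n = j n) -> F i = F j.

Definition kernel := tidx D -> tidx D -> R.

Definition kernel_on J (k : kernel) : Prop :=
  (forall j, depends_on J (k^~ j)) /\ (forall i, depends_on J (k i)).

(** For [kernel_on J k] this is a matrix acting on the axes in [J], tensored with the identity on
    the others. *)
Definition kop J (k : kernel) F : tensor R D :=
  fun i => \sum_(j | agree J i j) k i j * F j.

Lemma agreeP J i j : reflect (forall n, n \notin J -> j n = i n) (agree J i j).
Proof.
apply: (iffP forallP) => h n; first by move=> nJ; apply/eqP; exact: (implyP (h n)).
by apply/implyP => nJ; rewrite h.
Qed.

Lemma agree_refl J i : agree J i i.
Proof. exact/agreeP. Qed.

Lemma agree_sym J i j : agree J i j = agree J j i.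
Proof. by apply/agreeP/agreeP => h n nJ; rewrite h. Qed.

Lemma agree_transl J i j k : agree J i j -> agree J i k = agree J j k.
Proof.
by move=> /agreeP ij; apply/agreeP/agreeP => h n nJ; rewrite h // ij.
Qed.

Lemma agree_setT i j : agree setT i j.
Proof. by apply/agreeP => n; rewrite inE. Qed.

Lemma agree_mix J i j : agree J j (mix J i j).
Proof. by apply/agreeP => n /negbTE nJ; rewrite ffunE nJ. Qed.

Lemma depends_on_mix J F i j : depends_on J F -> F (mix J i j) = F i.
Proof. by apply=> n nJ; rewrite ffunE nJ. Qed.

Lemma depends_onS J J' F : J \subset J' -> depends_on J F -> depends_on J' F.
Proof. by move=> /subsetP JJ' h i j ij; apply: h => n /JJ'; exact: ij. Qed.

Lemma kernel_onS J J' (k : kernel) : J \subset J' -> kernel_on J k -> kernel_on J' k.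
Proof. by move=> JJ' [h1 h2]; split=> ?; apply: depends_onS JJ' _. Qed.

Lemma kernel_onM J (k k' : kernel) : kernel_on J k -> kernel_on J k' ->
  kernel_on J (fun i j => k i j * k' i j).
Proof.
move=> [h1 h2] [h1' h2']; split=> j i i' ii'.
  by rewrite (h1 j _ _ ii') (h1' j _ _ ii').
by rewrite (h2 j _ _ ii') (h2' j _ _ ii').
Qed.

(** Swapping the coordinates outside [J] matches the two ranges, so inner products over a block can
    be taken at any base index. *)
Lemma sum_agree_const J F i i' : depends_on J F ->
  \sum_(j | agree J i j) F j = \sum_(j | agree J i' j) F j.
Proof.
move=> FJ; rewrite (reindex_onto (fun j => mix J j i) (fun j => mix J j i')) /=.
  apply: eq_big => j; last by move=> _; rewrite depends_on_mix.
  rewrite agree_mix /=; apply/eqP/agreeP => [<- n /negbTE nJ|h].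
    by rewrite ffunE nJ.
  apply/ffunP => n; rewrite !ffunE; case: ifPn => [->//|nJ].
  by rewrite h.
move=> j /agreeP ij; apply/ffunP => n; rewrite !ffunE.
by case: ifPn => [->//|nJ]; rewrite ij.
Qed.

(** The intermediate index is forced: it equals the input index on [J1] and the output index
    elsewhere, so the double sum collapses. *)
Lemma kop_comp_disjoint J1 J2 (k1 k2 : kernel) F : [disjoint J1 & J2] ->
  kernel_on J1 k1 -> kernel_on J2 k2 ->
  kop J1 k1 (kop J2 k2 F) = kop (J1 :|: J2) (fun i j => k1 i j * k2 i j) F.
Proof.
move=> dis [_ k1r] [k2l _]; apply/funext => i; rewrite /kop.
under eq_bigr do rewrite mulr_sumr.
rewrite (exchange_big_dep (agree (J1 :|: J2) i)) /=; last first.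
  move=> j k /agreeP ij /agreeP jk; apply/agreeP => n.
  by rewrite inE negb_or => /andP[n1 n2]; rewrite jk // ij.
apply: eq_bigr => k /agreeP ik; rewrite (big_pred1 (mix J1 k i)) => [|j /=].
  rewrite mulrA; congr (_ * _ * _).
    by apply: k1r => n n1; rewrite ffunE n1.
  apply: k2l => n n2; rewrite ffunE; case: ifPn => // n1.
  by move/pred0P/(_ n): dis; rewrite /= n1 n2.
apply/andP/eqP => [[/agreeP ij /agreeP jk]|->].
  apply/ffunP => n; rewrite ffunE; case: ifPn => n1; last exact: ij.
  rewrite jk //; apply/negP => n2.
  by move/pred0P/(_ n): dis; rewrite /= n1 n2.
split; first exact: agree_mix.
apply/agreeP => n n2; rewrite ffunE; case: ifPn => // n1.
by rewrite ik // inE negb_or n1.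
Qed.

Lemma kop_comm_disjoint J1 J2 (k1 k2 : kernel) F : [disjoint J1 & J2] ->
  kernel_on J1 k1 -> kernel_on J2 k2 ->
  kop J1 k1 (kop J2 k2 F) = kop J2 k2 (kop J1 k1 F).
Proof.
move=> dis h1 h2; rewrite !kop_comp_disjoint //; last by rewrite disjoint_sym.
by rewrite setUC; congr kop; apply/funext => i; apply/funext => j; rewrite mulrC.
Qed.

Lemma kop_comp J (k1 k2 : kernel) F : kop J k1 (kop J k2 F) =
  kop J (fun i k => \sum_(j | agree J i j) k1 i j * k2 j k) F.
Proof.
apply/funext => i; rewrite /kop.
under eq_bigr => j ij.
  rewrite mulr_sumr (eq_bigl (agree J i)) => [|k]; last by rewrite -(agree_transl k ij).
  over.
rewrite exchange_big /=; apply: eq_bigr => k ik; rewrite mulr_suml.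
by apply: eq_bigr => j _; rewrite mulrA.
Qed.

Definition nsq F : R := \sum_i F i ^+ 2.

Lemma nsq_ge0 F : 0 <= nsq F.
Proof. by apply: sumr_ge0 => i _; exact: sqr_ge0. Qed.

Lemma nsq_eq0 F : nsq F = 0 -> F = fun=> 0.
Proof.
move=> /eqP; rewrite psumr_eq0 => [/allP h|i _]; last exact: sqr_ge0.
by apply/funext => i; apply/eqP; rewrite -sqrf_eq0; apply: h; rewrite mem_index_enum.
Qed.

Lemma kop_adj J (k : kernel) F G : (forall i j, k i j = k j i) ->
  \sum_i kop J k F i * G i = \sum_i F i * kop J k G i.
Proof.
move=> ksym; rewrite /kop.
under eq_bigr do rewrite mulr_suml.
under [RHS]eq_bigr do rewrite mulr_sumr.
rewrite (exchange_big_dep predT) //=; apply: eq_bigr => j _.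
rewrite (eq_bigl (agree J j)) => [|i]; last exact: agree_sym.
by apply: eq_bigr => i _; rewrite ksym; ring.
Qed.

Lemma kopB J (k : kernel) F G :
  kop J k (fun i => F i - G i) = fun i => kop J k F i - kop J k G i.
Proof.
apply/funext => i; rewrite /kop -sumrB.
by apply: eq_bigr => j _; rewrite mulrBr.
Qed.

(* Pythagoras for the orthogonal projection [kop J k]. *)
Lemma nsq_kop_proj J (k : kernel) F G : (forall i j, k i j = k j i) ->
  (forall H, kop J k (kop J k H) = kop J k H) ->
  nsq (fun i => F i - kop J k G i) <=
  nsq (fun i => F i - kop J k F i) + nsq (fun i => F i - G i).
Proof.
move=> ksym kidem; set p := kop J k in kidem *.
pose H i := F i - G i.
have orth F' H' : \sum_i (F' i - p F' i) * p H' i = 0.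
  rewrite -(kop_adj J (fun i => F' i - p F' i) H' ksym) kopB -/p kidem.
  by rewrite big1 // => i _; rewrite subrr mul0r.
have pyth a b : \sum_i a i * b i = 0 -> nsq (fun i => a i + b i) = nsq a + nsq b.
  move=> ab; rewrite /nsq.
  transitivity (\sum_i (a i ^+ 2 + b i ^+ 2 + 2 * (a i * b i))).
    by apply: eq_bigr => i _; ring.
  by rewrite !big_split /= -mulr_sumr ab mulr0 addr0.
(* The first summand is orthogonal to the range of [p], the second lies in it, and [p] does not
   increase the norm of [H]. *)
have -> : (fun i => F i - p G i) = (fun i => (F i - p F i) + p H i).
  by apply/funext => i; rewrite /H /p kopB; ring.
rewrite pyth // lerD2l.
have -> : (fun i => F i - G i) = (fun i => (H i - p H i) + p H i).
  by apply/funext => i; rewrite subrK.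
by rewrite pyth // lerDr nsq_ge0.
Qed.

(** Kernel of $F \mapsto \sum_r U_r \langle V_r, F \rangle$; for orthonormal $U = V$, the projection
    onto their span. *)
Definition ker (I : finType) (U V : I -> tensor R D) : kernel :=
  fun i j => \sum_r U r i * V r j.

Lemma ker_on J (I : finType) (U V : I -> tensor R D) :
  (forall r, depends_on J (U r)) -> (forall r, depends_on J (V r)) ->
  kernel_on J (ker U V).
Proof.
move=> hU hV; split=> j i i' ii'; apply: eq_bigr => r _.
  by rewrite (hU _ _ _ ii').
by rewrite (hV _ _ _ ii').
Qed.

(* Orthogonal families whose members have norm 1 or 0, so that a family with
   fewer than [#|I|] orthonormal members can be padded with zeros. *)
Definition orthonormal0 J (I : finType) (U : I -> tensor R D) : Prop :=
  exists b : I -> bool, forall i r s,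
    \sum_(j | agree J i j) U r j * U s j = ((r == s) && b r)%:R.

Lemma kop_ker_sym (I : finType) (U : I -> tensor R D) i j : ker U U i j = ker U U j i.
Proof. by apply: eq_bigr => r _; rewrite mulrC. Qed.

Lemma kop_ker_idem J (I : finType) (U : I -> tensor R D) F : orthonormal0 J U ->
  kop J (ker U U) (kop J (ker U U) F) = kop J (ker U U) F.
Proof.
move=> [b on]; rewrite kop_comp; congr kop; apply/funext => i; apply/funext => k.
(* A member with [b r] false has norm zero, hence vanishes. *)
have Ub r : U r i * (b r)%:R = U r i.
  have := on i r r; rewrite eqxx /=; case: (b r) => [_|/eqP]; first by rewrite mulr1.
  rewrite psumr_eq0 => [/allP/(_ i (mem_index_enum _))|j _]; last exact: sqr_ge0.
  by rewrite agree_refl -expr2 sqrf_eq0 => /eqP ->; rewrite mul0r.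
rewrite /ker; under eq_bigr => j _.
  rewrite mulr_suml; under eq_bigr => r _ do rewrite mulr_sumr.
  over.
rewrite exchange_big /=; apply: eq_bigr => r _; rewrite exchange_big /=.
transitivity (\sum_s U r i * U s k * ((r == s) && b r)%:R).
  apply: eq_bigr => s _; rewrite -(on i) mulr_sumr.
  by apply: eq_bigr => j _; ring.
rewrite (bigD1 r) //= eqxx big1 ?addr0 => [|s].
  by rewrite mulrAC Ub.
by rewrite eq_sym => /negbTE ->; rewrite mulr0.
Qed.

End TensorOperators.

(** * Truncation of a matricization *)

Section Truncation.
Variables (R : realType) (K : nat) (D : 'I_K -> nat) (J : {set 'I_K}).

Definition row_idx (i : tidx D) : rowT D J := [ffun n => i (val n)].
Definition col_idx (i : tidx D) : colT D J := [ffun n => i (val n)].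

Lemma merge_in (x : rowT D J) (y : colT D J) n (nJ : n \in J) :
  merge_idx x y n = x (exist _ n nJ).
Proof.
rewrite ffunE; move: (erefl (n \in J)); rewrite {2 3}nJ => e.
by rewrite (bool_irrelevance e nJ).
Qed.

Lemma merge_out (x : rowT D J) (y : colT D J) n (nJ : n \notin J) :
  merge_idx x y n = y (exist _ n nJ).
Proof.
rewrite ffunE; move: (erefl (n \in J)); rewrite {2 3}(negbTE nJ) => e.
by congr (y (exist _ n _)); exact: bool_irrelevance.
Qed.

Lemma row_merge x y : row_idx (merge_idx x y) = x.
Proof. by apply/ffunP => -[n nJ]; rewrite ffunE merge_in. Qed.

Lemma col_merge x y : col_idx (merge_idx x y) = y.
Proof. by apply/ffunP => -[n nJ]; rewrite ffunE merge_out. Qed.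

Lemma merge_row_col i : merge_idx (row_idx i) (col_idx i) = i.
Proof.
apply/ffunP => n; case: (boolP (n \in J)) => nJ.
  by rewrite (merge_in _ _ nJ) ffunE.
by rewrite (merge_out _ _ nJ) ffunE.
Qed.

Lemma agree_row i j : agree J i j = (col_idx j == col_idx i).
Proof.
apply/agreeP/eqP => [ij|ij n nJ]; first by apply/ffunP => -[n nJ]; rewrite !ffunE ij.
by have /ffunP/(_ (exist _ n nJ)) := ij; rewrite !ffunE.
Qed.

Lemma agree_col i j : agree (~: J) i j = (row_idx j == row_idx i).
Proof.
apply/agreeP/eqP => [ij|ij n].
  by apply/ffunP => -[n nJ]; rewrite !ffunE ij // inE negbK.
by rewrite inE negbK => nJ; have /ffunP/(_ (exist _ n nJ)) := ij; rewrite !ffunE.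
Qed.

Lemma sum_merge (P : pred (rowT D J)) (Q : pred (colT D J)) (F : tensor R D) :
  \sum_(i | P (row_idx i) && Q (col_idx i)) F i =
  \sum_(x | P x) \sum_(y | Q y) F (merge_idx x y).
Proof.
rewrite pair_big /= (reindex (fun p : rowT D J * colT D J => merge_idx p.1 p.2)) /=.
  by apply: eq_bigl => -[x y]; rewrite row_merge col_merge.
exists (fun i => (row_idx i, col_idx i)) => [[x y] _|i _] /=.
  by rewrite row_merge col_merge.
by rewrite merge_row_col.
Qed.

Lemma sum_agree_row (f : rowT D J -> R) i :
  \sum_(j | agree J i j) f (row_idx j) = \sum_x f x.
Proof.
rewrite (eq_bigl (fun j => xpredT (row_idx j) && pred1 (col_idx i) (col_idx j))).
  rewrite (sum_merge xpredT (pred1 (col_idx i)) (fun j => f (row_idx j))).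
  by apply: eq_bigr => x _; rewrite big_pred1_eq row_merge.
by move=> j; rewrite agree_row.
Qed.

Lemma sum_agree_col (f : colT D J -> R) i :
  \sum_(j | agree (~: J) i j) f (col_idx j) = \sum_y f y.
Proof.
rewrite (eq_bigl (fun j => pred1 (row_idx i) (row_idx j) && xpredT (col_idx j))).
  rewrite (sum_merge (pred1 (row_idx i)) xpredT (fun j => f (col_idx j))).
  by rewrite big_pred1_eq; apply: eq_bigr => y _; rewrite col_merge.
by move=> j; rewrite agree_col andbT.
Qed.

Lemma sum_row_col (f : rowT D J -> R) (g : colT D J -> R) :
  \sum_i f (row_idx i) * g (col_idx i) = (\sum_x f x) * (\sum_y g y).
Proof.
rewrite (sum_merge xpredT xpredT (fun i => f (row_idx i) * g (col_idx i))).
rewrite mulr_suml; apply: eq_bigr => x _; rewrite mulr_sumr.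
by apply: eq_bigr => y _; rewrite row_merge col_merge.
Qed.

End Truncation.

(** * Families of singular vectors padded to the width of the network *)

Section Padding.
Variables (R : realType) (K : nat) (D : 'I_K -> nat).
Implicit Types (J : {set 'I_K}).

(** A node always has [rk] vectors, while a truncation may keep fewer; the missing ones are zero. *)
Definition pad (rk : nat) (e : seq nat) (u : nat -> tensor R D) (r : 'I_rk) :
  tensor R D := fun i => if (r < size e)%N then u (nth 0%N e r) i else 0.

Lemma sum_pad (rk m : nat) (S : {set 'I_m}) (F : nat -> R) : (#|S| <= rk)%N ->
  \sum_(r < rk) (if (r < #|S|)%N then F (nth 0%N (map val (enum S)) r) else 0) =
  \sum_(d in S) F d.
Proof.
move=> Srk; rewrite -big_mkcond /= -(big_ord_widen rk (fun r => F (nth 0%N (map val (enum S)) r)) Srk).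
have -> : \sum_(d in S) F d = \sum_(d <- map val (enum S)) F d.
  by rewrite big_map big_enum.
rewrite (big_nth 0%N) big_mkord.
by rewrite size_map -cardE.
Qed.

Lemma pad_depends_on J (rk : nat) (e : seq nat) (u : nat -> tensor R D) :
  (forall d, depends_on J (u d)) -> forall r : 'I_rk, depends_on J (pad e u r).
Proof. by move=> uJ r i j ij; rewrite /pad (uJ _ _ _ ij). Qed.

Lemma pad_orthonormal0 J (rk m : nat) (S : {set 'I_m}) (u : nat -> tensor R D) :
  (forall i d d', (d < m)%N -> (d' < m)%N ->
     \sum_(j | agree J i j) u d j * u d' j = (d == d')%:R) ->
  orthonormal0 J (@pad rk (map val (enum S)) u).
Proof.
move=> on; set e := map val (enum S).
have em k : (k < size e)%N -> (nth 0%N e k < m)%N.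
  by move=> ke; have /mapP[d _ ->] := mem_nth 0%N ke; exact: ltn_ord.
have ue : uniq e by rewrite map_inj_uniq ?enum_uniq //; exact: val_inj.
exists (fun r : 'I_rk => (r < size e)%N) => i r s; rewrite /pad.
case: ltnP => re; last by rewrite andbF big1 // => j _; rewrite mul0r.
case: ltnP => se; last first.
  rewrite big1 => [|j _]; last by rewrite mulr0.
  by have [rs|] := eqVneq r s; first by rewrite rs ltnNge se in re.
by rewrite andbT on ?em // nth_uniq.
Qed.

(** Each [v d] is constant while the axes in [J] are summed, so orthonormality of the [u d] leaves
    exactly the selected terms. *)
Lemma pad_proj J (rk m : nat) (S : {set 'I_m}) (s : nat -> R)
    (u v : nat -> tensor R D) (A : tensor R D) : (#|S| <= rk)%N ->
  (forall i, A i = \sum_(d < m) s d * u d i * v d i) ->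
  (forall d, depends_on (~: J) (v d)) ->
  (forall i d d', (d < m)%N -> (d' < m)%N ->
     \sum_(j | agree J i j) u d j * u d' j = (d == d')%:R) ->
  kop J (ker (@pad rk (map val (enum S)) u) (@pad rk (map val (enum S)) u)) A =
  fun i => \sum_(d in S) s d * u d i * v d i.
Proof.
move=> Srk Ae vJ on; set e := map val (enum S); apply/funext => i.
rewrite /kop /ker; under eq_bigr do rewrite mulr_suml.
rewrite exchange_big /= -(sum_pad (fun d => s d * u d i * v d i) Srk).
have em k : (k < size e)%N -> (nth 0%N e k < m)%N.
  by move=> ke; have /mapP[d _ ->] := mem_nth 0%N ke; exact: ltn_ord.
apply: eq_bigr => r _; rewrite cardE -(size_map val (enum S)) -/e /pad.
case: ifP => [re|_]; last by rewrite big1 // => j _; rewrite !mul0r.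
set d := nth 0%N e r; have dm : (d < m)%N by exact: em.
transitivity (u d i * \sum_(d' < m) s d' * v d' i * \sum_(j | agree J i j) u d j * u d' j).
  under [in RHS]eq_bigr do rewrite mulr_sumr.
  rewrite exchange_big /= mulr_sumr; apply: eq_bigr => j ij.
  rewrite Ae -mulrA mulr_sumr; congr (_ * _); apply: eq_bigr => d' _.
  rewrite -(vJ d' i j) => [|n]; first by ring.
  by rewrite inE => nJ; rewrite (agreeP _ _ _ ij).
rewrite (bigD1 (Ordinal dm)) //= on // eqxx big1 ?addr0 => [|d' d'd]; first by rewrite mulr1; ring.
by rewrite on // eq_sym (negbTE (d'd : nat_of_ord d' != d)) mulr0.
Qed.

End Padding.

(** Projecting onto the selected left singular vectors, or onto the matching right ones, gives the
    same truncated decomposition. Both families are returned for the two children of a binary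
    root. *)
Lemma low_rank_truncation (R : realType) (K : nat) (D : 'I_K -> nat)
    (J : {set 'I_K}) (A : tensor R D) (rk : nat) (delta : R) :
  (0 < rk)%N -> 0 <= delta -> 0 < nsq A -> QE A J <= delta * ln rk%:R ->
  exists U V : 'I_rk -> tensor R D,
    [/\ forall r, depends_on J (U r), forall r, depends_on (~: J) (V r),
        orthonormal0 J U /\ orthonormal0 (~: J) V,
        kop J (ker U U) A = kop (~: J) (ker V V) A &
        nsq (fun i => A i - kop J (ker U U) A i) <= delta * nsq A].
Proof.
move=> rk0 delta0 A0; rewrite /QE /QEmat; set M := @matricize R K D A J.
(* Existence of a decomposition rules out the default value of [singvals]. *)
have : is_svd M (singvals M).
  rewrite /singvals; case: pselect => [h|[]]; last exact: svd_exists.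
  by case: cid.
move: (singvals M) => s [u0 [v0 [_ uu vv MUV]]].
pose u d i := u0 d (@row_idx K D J i); pose v d i := v0 d (@col_idx K D J i).
have AE i : A i = \sum_(d < size s) s`_d * u d i * v d i.
  by rewrite -MUV /M /matricize merge_row_col.
have uJ d : depends_on J (u d).
  move=> i j ij; rewrite /u; congr (u0 d _); apply/ffunP => -[n nJ].
  by rewrite !ffunE ij.
have vJ d : depends_on (~: J) (v d).
  move=> i j ij; rewrite /v; congr (v0 d _); apply/ffunP => -[n nJ].
  by rewrite !ffunE ij // inE.
have uon i d d' : (d < size s)%N -> (d' < size s)%N ->
    \sum_(j | agree J i j) u d j * u d' j = (d == d')%:R.
  by move=> ds d's; rewrite -uu // -(sum_agree_row (fun x => u0 d x * u0 d' x) i).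
have von i d d' : (d < size s)%N -> (d' < size s)%N ->
    \sum_(j | agree (~: J) i j) v d j * v d' j = (d == d')%:R.
  by move=> ds d's; rewrite -vv // -(sum_agree_col (fun x => v0 d x * v0 d' x) i).
(* The products of left and right singular vectors are orthonormal. Taking all indices gives the
   norm of [A], the complement of [S] the truncation error. *)
have nsqE (E : {set 'I_(size s)}) :
    nsq (fun i => \sum_(d in E) s`_d * u d i * v d i) = \sum_(d in E) s`_d ^+ 2.
  rewrite /nsq.
  under eq_bigr => i _.
    rewrite expr2 mulr_suml; under eq_bigr => d _ do rewrite mulr_sumr.
    over.
  rewrite exchange_big /=; apply: eq_bigr => d dE; rewrite exchange_big /=.
  transitivity (\sum_(d' in E) s`_d * s`_d' * (d == d')%:R).
    apply: eq_bigr => d' _.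
    transitivity (s`_d * s`_d' * \sum_i (u d i * u d' i) * (v d i * v d' i)).
      by rewrite mulr_sumr; apply: eq_bigr => i _; ring.
    rewrite (sum_row_col (fun x => u0 d x * u0 d' x) (fun y => v0 d y * v0 d' y)).
    by rewrite uu // vv // -natrM mulnb andbb.
  rewrite (bigD1 d) //= eqxx mulr1 -expr2 big1 ?addr0 // => d' /andP[_ d'd].
  by rewrite eq_sym (negbTE d'd) mulr0.
have tot : \sum_(x <- s) x ^+ 2 = nsq A.
  have -> : A = fun i => \sum_(d in [set: 'I_(size s)]) s`_d * u d i * v d i.
    by apply/funext => i; rewrite AE; apply: eq_bigl => d; rewrite inE.
  by rewrite nsqE (big_nth 0) big_mkord; apply: eq_bigl => d; rewrite inE.
rewrite tot gt_eqF // => ent.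
have [S [Srk tail]] := entropy_tail rk0 delta0 (esym tot) A0 ent.
pose U := @pad R K D rk (map val (enum S)) u.
pose V := @pad R K D rk (map val (enum S)) v.
have UA : kop J (ker U U) A = fun i => \sum_(d in S) s`_d * u d i * v d i.
  exact: pad_proj.
have VA : kop (~: J) (ker V V) A = fun i => \sum_(d in S) s`_d * u d i * v d i.
  rewrite (@pad_proj _ _ _ _ _ _ S (nth 0 s) v u A Srk) ?setCK //.
    by apply/funext => i; apply: eq_bigr => d _; rewrite mulrAC.
  by move=> i; rewrite AE; apply: eq_bigr => d _; rewrite mulrAC.
exists U, V; split; [exact: pad_depends_on|exact: pad_depends_on| | |].
- by split; exact: pad_orthonormal0.
- by rewrite UA VA.
- rewrite UA (_ : (fun i => _) = fun i => \sum_(d in ~: S) s`_d * u d i * v d i) ?nsqE //.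
  apply/funext => i; rewrite AE (bigID [in S]) /= addrC addrK.
  by apply: eq_bigl => d; rewrite inE.
Qed.

(** * The network as a composition of projections *)

Section NodeSets.
Local Open Scope nat_scope.
Variables (P L : nat).

(** The leaves below the first [q] children of node [n] of level [l + 1]; [l] is the level of the
    children. *)
Definition first_children (l n q : nat) : {set 'I_(nleaves P L)} :=
  [set m : 'I_(nleaves P L) | 2 ^ P * n <= m %/ 2 ^ (P * l) < 2 ^ P * n + q].

Lemma first_children0 l n : first_children l n 0 = set0.
Proof. by apply/setP => m; rewrite !inE addn0 leqNgt andNb. Qed.

Lemma first_childrenS l n q :
  first_children l n q.+1 = node_leaves P L l (2 ^ P * n + q) :|: first_children l n q.
Proof.
apply/setP => m; rewrite !inE addnS ltnS [X in _ && X]leq_eqVlt andb_orr.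
by congr (_ || _); case: eqP => [->|]; rewrite ?leq_addr ?andbF.
Qed.

Lemma node_first_children_disjoint l n q :
  [disjoint node_leaves P L l (2 ^ P * n + q) & first_children l n q].
Proof.
by apply/pred0P => m; rewrite /= !inE; case: eqP => //= ->; rewrite ltnn andbF.
Qed.

Lemma first_children_all l n : first_children l n (2 ^ P) = node_leaves P L l.+1 n.
Proof.
apply/setP => m; rewrite !inE mulnS [P + _]addnC expnD divnMA.
move: (m %/ _) => x; rewrite eqn_leq -(ltnS (x %/ _)) ltn_divLR ?expn_gt0 //.
by rewrite leq_divRL ?expn_gt0 // mulSn andbC [n * _]mulnC [2 ^ P + _ in RHS]addnC.
Qed.

Lemma child_sub l n k : k < 2 ^ P ->
  node_leaves P L l (2 ^ P * n + k) \subset node_leaves P L l.+1 n.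
Proof.
move=> kP; rewrite -first_children_all; apply/subsetP => m; rewrite !inE => /eqP ->.
by rewrite leq_addr ltn_add2l.
Qed.

Lemma child_lt l n k : l.+1 <= L -> n < 2 ^ (P * (L - l.+1)) -> k < 2 ^ P ->
  2 ^ P * n + k < 2 ^ (P * (L - l)).
Proof.
move=> lL nl kP; rewrite -subSS subSn // mulnS expnD.
by apply: (@leq_trans (2 ^ P * n.+1)); rewrite ?leq_mul2l ?nl ?orbT // mulnS addnC ltn_add2r.
Qed.

Lemma node_leaves_root : node_leaves P L L 0 = setT.
Proof.
apply/setP => m; rewrite !inE divn_small // (leq_trans (ltn_ord m)) //.
by rewrite /nleaves -expnM mulnC.
Qed.

Lemma node_leaves0 (m : 'I_(nleaves P L)) : node_leaves P L 0 m = [set m].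
Proof. by apply/setP => x; rewrite !inE muln0 divn1. Qed.

(* The number of proper descendants of a node at level [l]. *)
Fixpoint ndesc (l : nat) : nat := if l is l'.+1 then 2 ^ P * (ndesc l').+1 else 0.

End NodeSets.

Section Network.
Variables (R : realType) (P L rk : nat) (D : 'I_(nleaves P L) -> nat).
Variables (A : tensor R D) (i0 : tidx D) (U : nat -> nat -> 'I_rk -> tensor R D).
Hypothesis U_dep : forall l n, (l < L)%N -> (n < 2 ^ (P * (L - l)))%N ->
  forall r, depends_on (node_leaves P L l n) (U l n r).

Definition node_proj (l n : nat) : tensor R D -> tensor R D :=
  kop (node_leaves P L l n) (ker (U l n) (U l n)).

(* The projections of all proper descendants of the node, leaves outermost. *)
Fixpoint inner_proj (l n : nat) (F : tensor R D) : tensor R D :=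
  if l is l'.+1 then
    iteri (2 ^ P) (fun k G => inner_proj l' (2 ^ P * n + k) (node_proj l' (2 ^ P * n + k) G)) F
  else F.

(** [U 0 n r] depends on axis [n] only, so the other coordinates are filled from the arbitrary index
    [i0]. *)
Definition leaf_vec (n : 'I_(nleaves P L)) (r : 'I_rk) (x : 'I_(D n)) : R :=
  U 0 n r [ffun m => dfwith i0 x m].

Definition node_coef (l n : nat) (r : 'I_rk) (c : {ffun 'I_(2 ^ P) -> 'I_rk}) : R :=
  \sum_(j | agree (node_leaves P L l n) i0 j)
    (\prod_(k < 2 ^ P) U l.-1 (2 ^ P * n + k) (c k) j) * U l n r j.

(** The root is not projected: [A] itself takes the place of a node vector. *)
Definition root_coef (c : {ffun 'I_(2 ^ P) -> 'I_rk}) : R :=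
  \sum_j (\prod_(k < 2 ^ P) U L.-1 k (c k) j) * A j.

Let phi := tn_phi leaf_vec node_coef.

Lemma leaf_phi n r : (0 < L)%N -> (n < 2 ^ (P * L))%N -> phi 0 n r = U 0 n r.
Proof.
move=> L0 nl; apply/funext => i; rewrite /phi /=.
case: insubP => [m _ mn|]; last first.
  by rewrite /nleaves -expnM [(L * P)%N]mulnC nl.
rewrite /leaf_vec -mn.
have Um : depends_on (node_leaves P L 0 m) (U 0 m r) by apply: U_dep; rewrite ?subn0 ?mn.
apply: Um => x; rewrite node_leaves0 inE => /eqP ->.
by rewrite ffunE dfwith_in.
Qed.

Lemma phi_depends_on l n r : (l < L)%N -> (n < 2 ^ (P * (L - l)))%N ->
  depends_on (node_leaves P L l n) (phi l n r).
Proof.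
elim: l n r => [|l IH] n r lL nl.
  by rewrite leaf_phi //; [exact: U_dep|rewrite -[L]subn0].
move=> i j ij; rewrite /phi /=; apply: eq_bigr => c _; congr (_ * _).
apply: eq_bigr => k _; apply: IH; rewrite ?child_lt ?(ltnW lL) // => m mn.
by apply: ij; apply: (subsetP (child_sub _ _ _ (ltn_ord k))).
Qed.

Lemma depends_on_prod (I : finType) (J : {set 'I_(nleaves P L)}) (f : I -> tensor R D) :
  (forall k, depends_on J (f k)) -> depends_on J (fun i => \prod_k f k i).
Proof. by move=> fJ i j ij; apply: eq_bigr => k _; exact: fJ. Qed.

(** Children have disjoint leaf sets, so their operators merge into one with the product kernel on
    the union. *)
Lemma iteri_children l n q (T : nat -> tensor R D -> tensor R D)
    (V W : nat -> 'I_rk -> tensor R D) F :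
  (forall k, (k < q)%N ->
    [/\ forall G, T k G = kop (node_leaves P L l (2 ^ P * n + k)) (ker (V k) (W k)) G,
      forall r, depends_on (node_leaves P L l (2 ^ P * n + k)) (V k r)
      & forall r, depends_on (node_leaves P L l (2 ^ P * n + k)) (W k r)]) ->
  kernel_on (first_children P L l n q) (fun i j => \prod_(k < q) ker (V k) (W k) i j) /\
  iteri q T F = kop (first_children P L l n q) (fun i j => \prod_(k < q) ker (V k) (W k) i j) F.
Proof.
elim: q => [|q IH] TVW.
  split; first by split=> j i i' _; rewrite !big_ord0.
  apply/funext => i; rewrite /= first_children0 /kop (big_pred1 i) => [|j].
    by rewrite big_ord0 mul1r.
  apply/agreeP/eqP => [h|->//]; apply/ffunP => n'; apply: h.
  by rewrite inE.
have [Kq Eq] := IH (fun k kq => TVW k (ltnW kq)).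
have [Tq Vq Wq] := TVW q (ltnSn q).
have -> : (fun i j => \prod_(k < q.+1) ker (V k) (W k) i j) =
    (fun i j => ker (V q) (W q) i j * \prod_(k < q) ker (V k) (W k) i j).
  by apply/funext => i; apply/funext => j; rewrite big_ord_recr mulrC.
have Kq' := ker_on Vq Wq.
rewrite first_childrenS; split.
  apply: kernel_onM; first by apply: kernel_onS Kq'; rewrite subsetUl.
  by apply: kernel_onS Kq; rewrite subsetUr.
rewrite /= Eq Tq kop_comp_disjoint //; exact: node_first_children_disjoint.
Qed.

(** Distributivity yields one term per choice [c] of a vector at every child, which is how the
    network indexes its coefficients. *)
Lemma prod_ker (V W : 'I_(2 ^ P) -> 'I_rk -> tensor R D) i j :
  \prod_k ker (V k) (W k) i j =
  \sum_(c : {ffun 'I_(2 ^ P) -> 'I_rk}) (\prod_k V k (c k) i) * (\prod_k W k (c k) j).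
Proof.
rewrite /ker bigA_distr_bigA /=; apply: eq_bigr => c _.
by rewrite -big_split.
Qed.

(** By induction the children contribute, for each [c], a product of [phi] times a product of [U].
    Contracting the latter with the vectors of the node gives [node_coef], and what remains is the
    recursion of [phi]. *)
Lemma subtree_kop l n F : (l < L)%N -> (n < 2 ^ (P * (L - l)))%N ->
  inner_proj l n (node_proj l n F) =
  kop (node_leaves P L l n) (ker (phi l n) (U l n)) F.
Proof.
elim: l n F => [|l IH] n F lL nl.
  rewrite /= /node_proj; congr (kop _ (ker _ _)).
  by apply/funext => r; rewrite leaf_phi // -[L]subn0.
have lL' := ltnW lL.
have dep (c : {ffun 'I_(2 ^ P) -> 'I_rk}) : depends_on (node_leaves P L l.+1 n)
    (fun j => \prod_(k < 2 ^ P) U l (2 ^ P * n + k) (c k) j).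
  apply: depends_on_prod => k; apply: depends_onS (child_sub _ _ _ (ltn_ord k)) _.
  by apply: U_dep; rewrite ?child_lt.
rewrite /= (@iteri_children l n _ _ (fun k => phi l (2 ^ P * n + k)) (fun k => U l (2 ^ P * n + k)) _ _).2.
  rewrite first_children_all /node_proj kop_comp; congr kop.
  apply/funext => i; apply/funext => j.
  under eq_bigr => k _ do rewrite (prod_ker (fun k => phi l (2 ^ P * n + k)) (fun k => U l (2 ^ P * n + k))) /ker mulr_sumr.
  rewrite exchange_big /=; apply: eq_bigr => r _.
  under eq_bigr => k _ do rewrite mulr_suml.
  rewrite exchange_big /= mulr_suml; apply: eq_bigr => c _.
  (* The inner product moves from base index [i] to [i0], where the coefficient is defined. *)
  rewrite /node_coef /= -(@sum_agree_const _ _ _ (node_leaves P L l.+1 n)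
    (fun j => (\prod_(k < 2 ^ P) U l (2 ^ P * n + k) (c k) j) * U l.+1 n r j) i).
    by rewrite !mulr_suml; apply: eq_bigr => k _; rewrite /phi; ring.
  move=> x y xy; congr (_ * _); last exact: U_dep xy.
  exact: dep xy.
move=> k kP; split=> [G|r|r].
- by apply: IH; rewrite ?child_lt.
- by apply: phi_depends_on; rewrite ?child_lt.
- by apply: U_dep; rewrite ?child_lt.
Qed.

Lemma tn_tensorE : (0 < L)%N -> tn_tensor leaf_vec node_coef root_coef = inner_proj L 0 A.
Proof.
move=> L0; rewrite -[in inner_proj _ _ _](prednK L0) /=.
have Ll : (L.-1 < L)%N by rewrite prednK.
have ok k : (k < 2 ^ P)%N -> (2 ^ P * 0 + k < 2 ^ (P * (L - L.-1)))%N.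
  by move=> kP; rewrite child_lt ?prednK // expn_gt0.
rewrite (@iteri_children L.-1 0 _ _ (fun k => phi L.-1 (2 ^ P * 0 + k)) (fun k => U L.-1 (2 ^ P * 0 + k)) _ _).2.
  rewrite first_children_all prednK // node_leaves_root; apply/funext => i.
  rewrite /kop /tn_tensor [RHS](eq_bigl predT) => [|j]; last by rewrite agree_setT.
  under [RHS]eq_bigr => j _ do rewrite (prod_ker (fun k => phi L.-1 (2 ^ P * 0 + k)) (fun k => U L.-1 (2 ^ P * 0 + k))) mulr_suml.
  rewrite exchange_big /=; apply: eq_bigr => c _; rewrite /root_coef mulr_suml.
  apply: eq_bigr => j _; rewrite muln0.
  under [in RHS]eq_bigr do rewrite add0n.
  under [X in _ = _ * X * _]eq_bigr do rewrite add0n.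
  by rewrite /phi; ring.
move=> k kP; split=> [G|r|r].
- by apply: subtree_kop; rewrite ?ok.
- by apply: phi_depends_on; rewrite ?ok.
- by apply: U_dep; rewrite ?ok.
Qed.

(** All factors act on blocks below the node, disjoint from [J]. This allows reordering at a binary
    root. *)
Lemma inner_proj_comm l n (J : {set 'I_(nleaves P L)}) (k : kernel R D) F : (l < L)%N -> (n < 2 ^ (P * (L - l)))%N ->
  [disjoint J & node_leaves P L l n] -> kernel_on J k ->
  kop J k (inner_proj l n F) = inner_proj l n (kop J k F).
Proof.
case: l => // l lL nl dis kJ /=.
pose T q G := inner_proj l (2 ^ P * n + q) (node_proj l (2 ^ P * n + q) G).
suff h q : (q <= 2 ^ P)%N -> kop J k (iteri q T F) = iteri q T (kop J k F) by exact: h.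
elim: q => // q IH qP; rewrite [iteri _ _ F]/= [RHS]/= -IH ?(ltnW qP) // /T.
have ok : (2 ^ P * n + q < 2 ^ (P * (L - l)))%N by rewrite child_lt // ltnW.
have lL' := ltnW lL.
rewrite !subtree_kop // kop_comm_disjoint //.
- by rewrite disjoint_sym (disjointWl (child_sub _ _ _ qP)) // disjoint_sym.
- by apply: ker_on => r; [exact: phi_depends_on|exact: U_dep].
Qed.

(** * Accumulation of the squared error *)

Hypothesis U_on : forall l n, (l < L)%N -> (n < 2 ^ (P * (L - l)))%N ->
  orthonormal0 (node_leaves P L l n) (U l n).
Variable delta : R.
Hypothesis U_err : forall l n, (l < L)%N -> (n < 2 ^ (P * (L - l)))%N ->
  nsq (fun i => A i - node_proj l n A i) <= delta.

Lemma node_proj_err l n F : (l < L)%N -> (n < 2 ^ (P * (L - l)))%N ->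
  nsq (fun i => A i - node_proj l n F i) <= delta + nsq (fun i => A i - F i).
Proof.
move=> lL nl; apply: le_trans (nsq_kop_proj A F (@kop_ker_sym _ _ _ _ _) _) _.
  by move=> H; apply: kop_ker_idem; exact: U_on.
by rewrite lerD2r; exact: U_err.
Qed.

Lemma inner_proj_err l n F : (l <= L)%N -> (n < 2 ^ (P * (L - l)))%N ->
  nsq (fun i => A i - inner_proj l n F i) <=
  (ndesc P l)%:R * delta + nsq (fun i => A i - F i).
Proof.
elim: l n F => [|l IH] n F lL nl; first by rewrite mul0r add0r.
rewrite [ndesc _ _]/= [inner_proj _ _]/=.
(* Generalized over the children already processed: each costs its own projection and those of its
   descendants. *)
suff h q : (q <= 2 ^ P)%N ->
    nsq (fun i => A i - iteri q (fun k G => inner_proj l (2 ^ P * n + k) (node_proj l (2 ^ P * n + k) G)) F i)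
    <= (q * (ndesc P l).+1)%:R * delta + nsq (fun i => A i - F i) by exact: h.
elim: q => [|q IHq] qP; first by rewrite mul0n mul0r add0r.
have ok : (2 ^ P * n + q < 2 ^ (P * (L - l)))%N by rewrite child_lt.
rewrite /=; apply: le_trans (IH _ _ (ltnW lL) ok) _.
rewrite mulSn addSn -addnS natrD mulrDl -addrA lerD2l.
apply: le_trans (node_proj_err _ lL ok) _.
rewrite -[X in X * delta]natr1 mulrDl mul1r addrAC [leRHS]addrC lerD2l.
exact: IHq (ltnW qP).
Qed.

End Network.

(** * Node count and the binary case *)

(** The count is the geometric sum of $Q^k$ for $1 \le k \le l$ with $Q = 2^P \ge 4$. *)
Lemma ndesc_le (P l : nat) : (1 < P)%N -> (0 < l)%N -> (ndesc P l + 3 <= 2 * 2 ^ (P * l))%N.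
Proof.
move=> P1; have P4 : (4 <= 2 ^ P)%N by rewrite (@leq_pexp2l 2 2 P).
case: l => // l _; elim: l => [|l IH]; first by rewrite /= muln1 muln1; lia.
rewrite [ndesc _ _]/= -/(ndesc P l.+1) [(P * l.+2)%N]mulnS expnD.
by move: (ndesc P l.+1) (2 ^ (P * l.+1))%N IH => d e; nia.
Qed.

(** At the root this is one more than the $2N - 3$ that the error budget allows. *)
Lemma ndesc_binary (l : nat) : (ndesc 1 l + 2 = 2 * 2 ^ l)%N.
Proof. by elim: l => //= l IH; rewrite expn1 [in RHS]expnS -IH; lia. Qed.

(* The two children of the root of a binary tree have complementary leaf sets,
   so a common projection of [A] for both of them costs only once. *)
Lemma binary_inner_proj_err (R : realType) (L rk : nat)
    (D : 'I_(nleaves 1 L.+1) -> nat) (A : tensor R D)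
    (U : nat -> nat -> 'I_rk -> tensor R D) (i0 : tidx D) (delta : R) :
  (forall l n, (l < L.+1)%N -> (n < 2 ^ (1 * (L.+1 - l)))%N ->
    [/\ forall r, depends_on (node_leaves 1 L.+1 l n) (U l n r),
        orthonormal0 (node_leaves 1 L.+1 l n) (U l n)
      & nsq (fun i => A i - node_proj U l n A i) <= delta]) ->
  node_proj U L 0 A = node_proj U L 1 A ->
  nsq (fun i => A i - inner_proj U L.+1 0 A i) <= (ndesc 1 L.+1).-1%:R * delta.
Proof.
move=> good AA.
have dep l n hl hn := let: And3 h _ _ := good l n hl hn in h.
have on l n hl hn := let: And3 _ h _ := good l n hl hn in h.
have err l n hl hn := let: And3 _ _ h := good l n hl hn in h.
have ok0 : (0 < 2 ^ (1 * (L.+1 - L)))%N by rewrite expn_gt0.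
have ok1 : (1 < 2 ^ (1 * (L.+1 - L)))%N by rewrite subSn // subnn.
have -> : inner_proj U L.+1 0 A =
    inner_proj U L 1 (inner_proj U L 0 (node_proj U L 0 A)).
  rewrite [LHS]/= expn1 /= muln0 !add0n; congr inner_proj.
  (* The right projection commutes past the left subtree, meets the common projection of [A] and is
     absorbed by idempotence. *)
  rewrite [node_proj U L 1 _]/node_proj (inner_proj_comm i0 dep) //.
  - by congr inner_proj; rewrite AA; apply: kop_ker_idem; exact: on.
  - by apply/pred0P => m; rewrite /= !inE; case: eqP => // ->.
  - by apply: ker_on => r; exact: dep.
apply: le_trans (inner_proj_err on err _ (leqnSn L) ok1) _.
(* Both subtrees are paid in full, the shared projection once. *)
apply: (@le_trans _ _ ((ndesc 1 L)%:R * delta + ((ndesc 1 L)%:R * delta + delta))).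
  rewrite lerD2l; apply: le_trans (inner_proj_err on err _ (leqnSn L) ok0) _.
  by rewrite lerD2l; exact: err.
have -> : ((ndesc 1 L.+1).-1 = ndesc 1 L + (ndesc 1 L + 1))%N by rewrite /=; lia.
by rewrite !natrD !mulrDl mul1r.
Qed.

(** * Choice of the projections and assembly of the network *)

Theorem theorem4 (R : realType) (P L rk : nat) (D : 'I_(nleaves P L) -> nat)
    (A : tensor R D) (eps : R) (mu : gridT P L -> 'I_(nleaves P L)) :
  (0 < P)%N -> (0 < L)%N -> (forall n, 0 < D n)%N -> (0 < rk)%N ->
  0 < eps ->
  compatible mu ->
  (forall (l : nat) (np : 'I_P -> nat), (l <= L)%N -> (forall p, np p < 2 ^ l)%N ->
     QE A (mu @: canon_block L l np) <=
       eps ^+ 2 / ((2 * (nleaves P L)%:R - 3) * fnorm A ^+ 2) * ln (rk%:R : R)) ->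
  exists (phi0 : forall n : 'I_(nleaves P L), 'I_rk -> 'I_(D n) -> R)
         (a : nat -> nat -> 'I_rk -> {ffun 'I_(2 ^ P) -> 'I_rk} -> R)
         (atop : {ffun 'I_(2 ^ P) -> 'I_rk} -> R),
    fnorm (fun i => tn_tensor phi0 a atop i - A i) <= eps.
Proof.
move=> P0 L0 D0 rk0 eps0 mu_comp QE_le.
(* The zero tensor, which has no normalized singular values, is generated by zero coefficients. *)
have [A0|A0] := eqVneq (nsq A) 0.
  exists (fun _ _ _ => 0), (fun _ _ _ _ => 0), (fun _ => 0).
  rewrite (nsq_eq0 A0) /fnorm big1 ?sqrtr0 ?ltW // => i _.
  by rewrite /tn_tensor big1 ?subr0 ?expr0n // => c _; rewrite mul0r.
have nsqA : 0 < nsq A by rewrite lt_neqAle eq_sym A0 nsq_ge0.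
(* With at least two leaves, the natural subtraction [2 * nleaves P L - 3] is exact and positive. *)
have leaves_ge : (4 <= 2 * nleaves P L)%N.
  by rewrite (@leq_mul 2 2 2) // /nleaves -expnM (@leq_pexp2l 2 1) // muln_gt0 L0.
set c : R := 2 * (nleaves P L)%:R - 3 in QE_le.
have cE : c = (2 * nleaves P L - 3)%:R.
  by rewrite natrB ?natrM // ltnW.
have c0 : 0 < c by rewrite cE ltr0n; lia.
rewrite /fnorm sqr_sqrtr -/(nsq A) ?nsq_ge0 // in QE_le.
(* The squared error allowed per projection; [c] of them fill the budget [eps ^+ 2]. *)
pose delta := eps ^+ 2 / c.
have delta0 : 0 <= delta by rewrite divr_ge0 ?sqr_ge0 // ltW.
have deltaE : eps ^+ 2 / (c * nsq A) * nsq A = delta.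
  by rewrite invfM mulrA divfK.
pose i0 : tidx D := [ffun n => Ordinal (D0 n)].
pose good (x : nat * nat) (W : ('I_rk -> tensor R D) * ('I_rk -> tensor R D)) :=
  let J := node_leaves P L x.1 x.2 in
  (x.1 < L)%N -> (x.2 < 2 ^ (P * (L - x.1)))%N ->
  [/\ forall r, depends_on J (W.1 r), forall r, depends_on (~: J) (W.2 r),
      orthonormal0 J W.1 /\ orthonormal0 (~: J) W.2,
      kop J (ker W.1 W.1) A = kop (~: J) (ker W.2 W.2) A &
      nsq (fun i => A i - kop J (ker W.1 W.1) A i) <= delta].
have [|W W_good] := boolp.choice (P := good).
  move=> [l n]; rewrite /good /=.
  have [lL|lL] := ltnP l L; last by exists (fun _ _ => 0, fun _ _ => 0).
  have [nl|nl] := ltnP n (2 ^ (P * (L - l))); last by exists (fun _ _ => 0, fun _ _ => 0).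
  have [np [np_lt J_np]] := node_is_canonical mu_comp (ltnW lL) nl.
  (* Canonical blocks are counted from the root, nodes from the leaves. *)
  have := QE_le (L - l)%N np (leq_subr _ _) np_lt; rewrite -J_np => QE_J.
  have [|U [V UV]] := low_rank_truncation rk0 _ nsqA QE_J.
    by rewrite divr_ge0 ?sqr_ge0 // mulr_ge0 ?ltW.
  by rewrite deltaE in UV; exists (U, V).
pose err U := nsq (fun i => A i - @inner_proj R P L rk D U L 0 A i).
have finish U : (forall l n, (l < L)%N -> (n < 2 ^ (P * (L - l)))%N ->
    forall r, depends_on (node_leaves P L l n) (U l n r)) ->
    err U <= (2 * nleaves P L - 3)%:R * delta ->
    exists phi0 a atop, fnorm (fun i => @tn_tensor R P L rk D phi0 a atop i - A i) <= eps.
  move=> U_dep U_err; exists (leaf_vec i0 U), (node_coef i0 U), (root_coef A U).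
  rewrite tn_tensorE // -[leRHS]ger0_norm ?(ltW eps0) // -sqrtr_sqr ler_wsqrtr //.
  move: U_err; rewrite -cE /delta mulrC divfK ?gt_eqF // /err /nsq.
  by under eq_bigr do rewrite -sqrrN opprB.
pose U l n := (W (l, n)).1.
have U_good l n : (l < L)%N -> (n < 2 ^ (P * (L - l)))%N ->
    [/\ forall r, depends_on (node_leaves P L l n) (U l n r),
        orthonormal0 (node_leaves P L l n) (U l n)
      & nsq (fun i => A i - node_proj U l n A i) <= delta].
  by move=> hl hn; have [h1 _ [h2 _] _ h3] := W_good (l, n) hl hn.
have [P1|P1] := ltnP 1 P.
  apply: (finish U) => [l n hl hn|]; first by case: (U_good l n hl hn).
  have on l n hl hn := let: And3 _ h _ := U_good l n hl hn in h.
  have ge l n hl hn := let: And3 _ _ h := U_good l n hl hn in h.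
  have ok : (0 < 2 ^ (P * (L - L)))%N by rewrite expn_gt0.
  apply: le_trans (inner_proj_err on ge A (leqnn L) ok) _.
  rewrite /nsq [X in _ + X]big1 ?addr0 => [|i _]; last by rewrite subrr expr0n.
  rewrite ler_wpM2r // ler_nat leq_subRL; last exact: ltnW.
  by have := ndesc_le P1 L0; rewrite /nleaves -expnM [(L * P)%N]mulnC addnC.
have PE : P = 1%N by apply/eqP; rewrite eqn_leq P1.
have [L' LE] : exists L', L = L'.+1 by exists L.-1; rewrite prednK.
subst P L.
(* The right child of the root receives the right singular vectors of the left child's
   decomposition, so both project [A] to the same tensor. *)
pose U' l n := if (l == L') && (n == 1%N) then (W (L', 0%N)).2 else U l n.
have ok0 : (0 < 2 ^ (1 * (L'.+1 - L')))%N by rewrite expn_gt0.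
have siblings : node_leaves 1 L'.+1 L' 1 = ~: node_leaves 1 L'.+1 L' 0.
  apply/setP => m; rewrite !inE; have := leaf_node_lt m (leqnSn L').
  by rewrite subSn // subnn; case: (_ %/ _)%N => [|[]].
have [_ V_dep [_ V_on] UV U_err] := W_good (L', 0%N) (leqnn _) ok0.
have AA : node_proj U' L' 0 A = node_proj U' L' 1 A.
  by rewrite /node_proj /U' eqxx /= siblings.
have U'_good l n : (l < L'.+1)%N -> (n < 2 ^ (1 * (L'.+1 - l)))%N ->
    [/\ forall r, depends_on (node_leaves 1 L'.+1 l n) (U' l n r),
        orthonormal0 (node_leaves 1 L'.+1 l n) (U' l n)
      & nsq (fun i => A i - node_proj U' l n A i) <= delta].
  move=> hl hn; have := U_good l n hl hn; rewrite /node_proj /U'.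
  case: ifP => // /andP[/eqP -> /eqP ->] _; rewrite siblings; split=> //.
  by rewrite -UV.
apply: (finish U') => [l n hl hn|]; first by case: (U'_good l n hl hn).
apply: le_trans (binary_inner_proj_err i0 U'_good AA) _.
rewrite ler_wpM2r // ler_nat /nleaves expn1.
by have := ndesc_binary L'.+1; lia.
Qed.
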